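(* Let $n \geq 5$ and let $T \subseteq S_n$ be a set of transpositions that generates $S_n$. Suppose that the transposition graph $G(T)$ is not isomorphic to the complete graph $K_n$. Then the group $\operatorname{Aut}(\operatorname{Cay}(S_n,T))$ is isomorphic to $S_n \times \operatorname{Aut}(G(T))$.
   Context: $S_n$ is the symmetric group on $[n]=\{1,\dots,n\}$, and a transposition is a permutation $(i\,j)$ with $i\neq j$. The transposition graph $G(T)$ is the simple graph with vertex set $[n]$ and edge set $E(T)=\{\{i,j\} : (i\,j)\in T\}$. The Cayley graph $\operatorname{Cay}(S_n,T)$ is the simple undirected graph with vertex set $S_n$ and edge set $\{\{a,ta\} : a\in S_n,\ t\in T\}$. For a graph $X$, $\operatorname{Aut}(X)$ denotes its group of graph automorphisms. *)

(* Defs.v *)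
From mathcomp Require Import all_boot all_fingroup.

Set Implicit Arguments.
Unset Strict Implicit.
Unset Printing Implicit Defensive.

Local Open Scope group_scope.

Record sgraph (V : finType) := SGraph {
  edges : {set {set V}};
  edges_card2 : forall e, e \in edges -> #|e| = 2 }.

Definition adj (V : finType) (G : sgraph V) (x y : V) : bool :=
  [set x; y] \in edges G.

Definition graph_iso (V W : finType) (G : sgraph V) (H : sgraph W) : Prop :=
  exists2 f : V -> W, bijective f & forall x y, adj H (f x) (f y) = adj G x y.

Definition graph_aut (V : finType) (G : sgraph V) : {set {perm V}} :=
  [set s : {perm V} | [forall x, forall y, adj G (s x) (s y) == adj G x y]].

Lemma graph_aut_group_set (V : finType) (G : sgraph V) :
  group_set (graph_aut G).
Proof.
apply/group_setP; split=> [|s t]; rewrite !inE.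
  by apply/forallP=> x; apply/forallP=> y; rewrite !perm1.
move=> /forallP Hs /forallP Ht; apply/forallP=> x; apply/forallP=> y.
by rewrite !permM (eqP (forallP (Ht _) _)) (forallP (Hs x) y).
Qed.

Canonical graph_aut_group (V : finType) (G : sgraph V) : {group {perm V}} :=
  Group (graph_aut_group_set G).

Lemma complete_card2 (V : finType) (e : {set V}) :
  e \in [set e : {set V} | #|e| == 2] -> #|e| = 2.
Proof. by rewrite inE => /eqP. Qed.

Definition complete_graph (V : finType) : sgraph V :=
  SGraph (@complete_card2 V).

Definition transposition (n : nat) (s : 'S_n) : Prop :=
  exists i j : 'I_n, i != j /\ s = tperm i j.

Definition transposition_edges (n : nat) (T : {set 'S_n}) : {set {set 'I_n}} :=
  [set [set i; j] | i in [set: 'I_n], j in [set: 'I_n]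
    & (i != j) && (tperm i j \in T)].

Lemma transposition_edges_card2 (n : nat) (T : {set 'S_n}) (e : {set 'I_n}) :
  e \in transposition_edges T -> #|e| = 2.
Proof.
by case/imset2P=> i j _; rewrite !inE /= => /andP[nij _] ->; rewrite cards2 nij.
Qed.

Definition transposition_graph (n : nat) (T : {set 'S_n}) : sgraph 'I_n :=
  SGraph (@transposition_edges_card2 n T).

(* The condition t != 1 removes loops; it is vacuous when T consists of
   transpositions.  The product is that of the group gT; in 'S_n it composes
   from left to right, i.e. (t * a) i = a (t i).  For T closed under inverses,
   a |-> a^-1 exchanges this graph with the one built from a * t. *)
Definition cayley_edges (gT : finGroupType) (T : {set gT}) : {set {set gT}} :=
  [set [set a; t * a] | a in [set: gT], t in T & t != 1].

Lemma cayley_edges_card2 (gT : finGroupType) (T : {set gT}) (e : {set gT}) :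
  e \in cayley_edges T -> #|e| = 2.
Proof.
case/imset2P=> a t _; rewrite !inE /= => /andP[_ nt1] ->.
by rewrite cards2 -{1}(mul1g a) (inj_eq (mulIg a)) eq_sym nt1.
Qed.

Definition cayley_graph (gT : finGroupType) (T : {set gT}) : sgraph gT :=
  SGraph (@cayley_edges_card2 gT T).

(* Main.v *)
(* Automorphisms a |-> h^-1 a g of the Cayley graph, with g in S_n and h in
   Aut(G(T)), realise the product group; what must be shown is that there are
   no others.  Counting common neighbours shows that an automorphism p fixing 1
   respects commutation and triangles in T, so by Whitney's argument it acts on
   T as conjugation by some h in Aut(G(T)); it remains to see that p = 1 if p
   also fixes T pointwise.  Such a p acts on the neighbours of t in T as
   p (s t) = s^d t for a "jump" d in Aut(G(T)), which fixes t, the edges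
   disjoint from t and the apexes of the triangles on t.
   If d exchanges the ends of t, comparing the two sides of the hexagon
   t s t = s t s gives G(T) = K_n when t lies in a triangle and n <= 4
   otherwise.  So jumps fix the ends of their edges, and the hexagon then forces
   them to act trivially on T. *)
Require Import Defs.
From mathcomp Require Import all_boot all_fingroup.

Set Implicit Arguments.
Unset Strict Implicit.
Unset Printing Implicit Defensive.

Local Open Scope group_scope.

(** * Transpositions: common points, commutation and products of two *)

Section Transpositions.
Variable V : finType.
Implicit Types (s t u v : {perm V}) (x y z i j k l : V).

Definition is_tperm s := exists i j, i != j /\ s = tperm i j.

Lemma tp_inv s : is_tperm s -> s^-1 = s.
Proof. by case=> i [j [_ ->]]; rewrite tpermV. Qed.

Lemma tp_sqr s : is_tperm s -> s * s = 1.
Proof. by move=> /tp_inv s1; rewrite -{1}s1 mulVg. Qed.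

Lemma tp_conj s u : is_tperm s -> is_tperm (s ^ u).
Proof.
case=> i [j [nij ->]]; exists (u i), (u j).
by rewrite tpermJ (inj_eq perm_inj).
Qed.

Lemma tp_moved s x : is_tperm s -> s x != x -> s = tperm x (s x).
Proof.
case=> i [j [nij ->]]; case: tpermP => [->|->|_ _] //; last by rewrite eqxx.
by rewrite tpermC.
Qed.

Lemma tp_invol s x : is_tperm s -> s (s x) = x.
Proof. by move=> ts; rewrite -permM tp_sqr ?perm1. Qed.

Lemma tperm_neq1 i j : (tperm i j != 1) = (i != j).
Proof.
apply/idP/idP => [|nij]; first by apply: contraNneq => ->; rewrite tperm1.
by apply: contraNneq nij => /permP/(_ i); rewrite tpermL perm1 => ->.
Qed.

Lemma tperm_eq i j k l : i != j ->
  tperm i j = tperm k l -> (k = i /\ l = j) \/ (k = j /\ l = i).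
Proof.
move=> nij e; have := congr1 (fun s : {perm V} => s i) e.
have := congr1 (fun s : {perm V} => s j) e.
rewrite tpermL tpermR; case: tpermP => [->|->|_ _] ij; last
  by rewrite ij eqxx in nij.
  by rewrite -ij; right.
by rewrite -ij; left.
Qed.

Lemma tp_moved2 s x y : is_tperm s -> s x != x -> s y != y -> y != x -> y = s x.
Proof.
move=> ts sx; rewrite {1}(tp_moved ts sx); case: tpermP => //.
by move=> ->; rewrite eqxx.
by rewrite eqxx.
Qed.

Lemma tp_common s t : is_tperm s -> is_tperm t -> s * t != t * s ->
  exists i j k, [/\ i != j, i != k, j != k, s = tperm i j & t = tperm i k].
Proof.
move=> [i [j [nij Es]]] tt nst.
have nE : s != t by apply: contraNneq nst => ->.
have [ti|ti] := boolP (t i != i).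
  have Et := tp_moved tt ti.
  exists i, j, (t i); split=> //; first by rewrite eq_sym.
  by apply: contraNneq nE => Ej; rewrite Es Et -Ej.
have [tj|tj] := boolP (t j != j).
  have Et := tp_moved tt tj.
  exists j, i, (t j); split=> //; rewrite 1?eq_sym //; last by rewrite tpermC.
  by rewrite eq_sym; apply: contraNneq nE => Ej; rewrite Es Et -Ej tpermC.
case/negP: nst; apply/eqP/commgP/conjg_fixP.
by move: ti tj; rewrite Es tpermJ !negbK => /eqP-> /eqP->.
Qed.

Lemma star_ncomm i j k : i != j -> i != k -> j != k ->
  tperm i j * tperm i k != tperm i k * tperm i j.
Proof.
move=> nij nik njk; apply: contraNneq nik => /permP/(_ j).
rewrite !permM tpermR tpermL [tperm i k j]tpermD // 1?eq_sym // tpermR => ->.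
by rewrite eqxx.
Qed.

(** As [x] and [w] differ, [x] fixes an end r of [w], and then [x * w] sends r to the other end. *)
Lemma tp_factor (x w : {perm V}) : is_tperm x -> is_tperm w -> x != w ->
  exists2 r, (x * w) r != r & w = tperm r ((x * w) r).
Proof.
move=> tx [a [b [nab ->]]] nxw.
have [xa|xa] := eqVneq (x a) a.
  by exists a; rewrite permM xa tpermL // eq_sym.
have nxab : x a != b by apply: contraNneq nxw => <-; rewrite -tp_moved.
have [xb|xb] := eqVneq (x b) b.
  by exists b; rewrite permM xb tpermR // tpermC.
by case/eqP: nxab; symmetry; apply: tp_moved2; rewrite // eq_sym.
Qed.

(** By [tp_factor], [w] swaps some point r with its image under [u * v]. This swap is [v] if [u]
    fixes r, [u] if [v] fixes [u r], and [u ^ v] if [v] fixes r. *)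
Lemma tp_decomp (x w : {perm V}) u v : is_tperm x -> is_tperm w ->
  is_tperm u -> is_tperm v -> u != v ->
  x * w = u * v -> [\/ w = u, w = v | w = u ^ v].
Proof.
move=> tx tw tu tv nuv E.
have nxw : x != w.
  apply: contraNneq nuv => xw; move: E; rewrite xw tp_sqr // => /esym/eqP.
  by rewrite -eq_invg_mul tp_inv // eq_sym.
have [r] := tp_factor tx tw nxw; rewrite E permM.
have [ur|ur] := eqVneq (u r) r.
  by rewrite ur => vr ->; constructor 2; rewrite -tp_moved.
have Eu := tp_moved tu ur.
have [vp|vp] := eqVneq (v (u r)) (u r).
  by rewrite vp => _ ->; constructor 1.
have [vr|vr] := eqVneq (v r) r.
  by move=> _ ->; constructor 3; rewrite [in RHS]Eu tpermJ vr.
case/eqP: nuv; rewrite Eu (tp_moved tv vr); congr tperm.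
exact: tp_moved2.
Qed.

(** Non-commuting transpositions have the form (i j), (i k), and both conjugates are (j k). *)
Lemma tp_braid s t : is_tperm s -> is_tperm t -> s * t != t * s ->
  s ^ t = t ^ s.
Proof.
move=> ts tt /(tp_common ts tt)[i [j [k [nij nik njk -> ->]]]].
rewrite !tpermJ !tpermL [tperm i k j]tpermD 1?[k == j]eq_sym //.
by rewrite [tperm i j k]tpermD // tpermC.
Qed.

Lemma moved_ncomm s t x : is_tperm s -> is_tperm t -> s != t -> s x != x ->
  t x != x ->
  s * t != t * s.
Proof.
move=> ts tt nst sx tx.
rewrite (tp_moved ts sx) (tp_moved tt tx) star_ncomm // 1?eq_sym //.
by apply: contraNneq nst => E; rewrite (tp_moved ts sx) (tp_moved tt tx) E.
Qed.
End Transpositions.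

Lemma eq_set2 (I : finType) (a b c d : I) : a != b ->
  [set a; b] = [set c; d] -> (c = a /\ d = b) \/ (c = b /\ d = a).
Proof.
move=> nab /setP E; move: (E a) (E b); rewrite !inE !eqxx orbT /=.
move=> /esym/orP[]/eqP Ea /esym/orP[]/eqP Eb; subst; auto.
  by rewrite eqxx in nab.
by rewrite eqxx in nab.
Qed.

(** * Adjacency and automorphisms of the two graphs, read off from T *)

Section Cayley.
Variables (n : nat) (T : {set 'S_n}).
Hypothesis hT : forall t : 'S_n, t \in T -> transposition t.
Hypothesis hgen : <<T>> = [set: 'S_n].
Implicit Types (s t u v g h a : 'S_n) (i j k x y : 'I_n).

Lemma tpT t : t \in T -> is_tperm t.
Proof. exact: hT. Qed.

Lemma notin1 : 1 \notin T.
Proof.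
by apply/negP => /tpT[i [j [nij /esym/eqP]]]; apply/negP; rewrite tperm_neq1.
Qed.

Lemma edge_neq i j : tperm i j \in T -> i != j.
Proof. by apply: contraTneq => ->; rewrite tperm1 notin1. Qed.

Lemma adj_transposition_graph i j :
  adj (transposition_graph T) i j = (tperm i j \in T).
Proof.
apply/imset2P/idP => [[x y _]|Tij].
  rewrite !inE /= => /andP[nxy Txy] /esym/(eq_set2 nxy)[] [-> ->] //.
  by rewrite tpermC.
by exists i j; rewrite ?inE //= Tij edge_neq.
Qed.

Lemma adj_cayley_graph a b : adj (cayley_graph T) a b = (b * a^-1 \in T).
Proof.
apply/imset2P/idP => [[c t _]|Tab].
  rewrite !inE => /andP[Tt nt].
  have nct : c != t * c by rewrite -{1}(mul1g c) (inj_eq (mulIg c)) eq_sym.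
  move=> /esym/(eq_set2 nct)[] [-> ->]; first by rewrite mulgK.
  by rewrite invMg mulKVg tp_inv //; apply: tpT.
exists a (b * a^-1); rewrite ?mulgKV ?inE ?Tab //=.
by apply: contraNneq notin1 => <-.
Qed.

Lemma aut_cayleyP (p : {perm 'S_n}) :
  reflect (forall a b, (p b * (p a)^-1 \in T) = (b * a^-1 \in T))
          (p \in graph_aut (cayley_graph T)).
Proof.
rewrite inE; apply: (iffP forallP) => H a.
  by move=> b; rewrite -!adj_cayley_graph (eqP (forallP (H a) b)).
by apply/forallP => b; rewrite !adj_cayley_graph H.
Qed.

Lemma aut_transP h :
  reflect (forall t, (t ^ h \in T) = (t \in T))
          (h \in graph_aut (transposition_graph T)).
Proof.
rewrite inE; apply: (iffP forallP) => [H t|H i].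
  have HT (s : 'S_n) : is_tperm s -> (s ^ h \in T) = (s \in T).
    case=> i [j [_ ->]]; rewrite tpermJ -!adj_transposition_graph.
    by have /forallP/(_ j)/eqP := H i.
  apply/idP/idP => Tt; last by rewrite HT //; apply: tpT.
  by rewrite -(HT t) // -(conjgK h t); apply: tp_conj; apply: tpT.
by apply/forallP => j; rewrite !adj_transposition_graph -tpermJ H.
Qed.

(** Connectedness of G(T): every element of T preserves S, hence so does the generated group, which
    contains each (i j). *)
Lemma edge_closed (S : {set 'I_n}) i : i \in S ->
  (forall x y, x \in S -> tperm x y \in T -> y \in S) -> forall j, j \in S.
Proof.
move=> Si clS j.
have : tperm i j \in 'N(S | 'P).
  have: <<T>> \subset 'N(S | 'P); last by rewrite hgen; move/subsetP; apply.
  rewrite gen_subG; apply/subsetP => t Tt; rewrite !inE; apply/subsetP=> x Sx.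
  rewrite inE /= /aperm; have [->//|tx] := eqVneq (t x) x.
  by apply: (clS x) => //; rewrite -tp_moved //; apply: tpT.
by move/(astabs_act i); rewrite /= /aperm tpermL Si.
Qed.

(** The inverse on [h] makes [bitrans] multiplicative in the pair (g, h). *)
Definition bitrans_fun g h a := h^-1 * a * g.

Lemma bitrans_inj g h : injective (bitrans_fun g h).
Proof. by move=> a b /mulIg/mulgI. Qed.

Definition bitrans g h : {perm 'S_n} := perm (@bitrans_inj g h).

Lemma bitransE g h a : bitrans g h a = h^-1 * a * g.
Proof. by rewrite permE. Qed.

(** The quotient b a^-1 is replaced by its conjugate under [h], and conjugation by [h] preserves
    T. *)
Lemma bitrans_aut g h : h \in graph_aut (transposition_graph T) ->
  bitrans g h \in graph_aut (cayley_graph T).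
Proof.
move/aut_transP => Hh; apply/aut_cayleyP => a b; rewrite !bitransE -[RHS]Hh.
by rewrite conjgE !invMg !invgK !mulgA mulgK.
Qed.

(** * Common neighbours in the Cayley graph *)

(* Since s^-1 = s, [a * s \in T] says that a is adjacent to s in the Cayley
   graph. *)
Definition common_nbrs s t := [set a | (a * s \in T) && (a * t \in T)].

Lemma mulTT t : t \in T -> t * t = 1.
Proof. by move=> Tt; exact: tp_sqr (tpT Tt). Qed.

Lemma invT t : t \in T -> t^-1 = t.
Proof. by move=> Tt; exact: tp_inv (tpT Tt). Qed.

Lemma conjT s t : t \in T -> s ^ t = t * s * t.
Proof. by move=> Tt; rewrite conjgE invT // mulgA. Qed.

(** If [a] is not 1, then a = (a s) s = (a t) t gives two factorisations into transpositions, to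
    which [tp_decomp] applies. *)
Lemma common_nbrs_sub s t a : s \in T -> t \in T -> s != t ->
  a \in common_nbrs s t -> [\/ a = 1, a = s * t | a = t * s].
Proof.
move=> Ts Tt nst; rewrite inE => /andP[Tas Tat].
have [->|na1] := eqVneq a 1; first by constructor 1.
have nE : a * t != t.
  by apply: contraNneq na1 => E; rewrite -(inj_eq (mulIg t)) mul1g E.
have E : (a * s) * s = (a * t) * t by rewrite -!mulgA !mulTT.
case: (tp_decomp (tpT Tas) (tpT Ts) (tpT Tat) (tpT Tt) nE E) => Es.
- by constructor 2; rewrite Es -mulgA mulTT // mulg1.
- by rewrite Es eqxx in nst.
by constructor 3; rewrite Es conjT // !mulgA mulTT // mul1g -mulgA mulTT ?mulg1.
Qed.

Lemma mulg_common_nbrs s t : s \in T -> t \in T ->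
  (s * t \in common_nbrs s t) = (t ^ s \in T).
Proof. by move=> Ts Tt; rewrite inE -[s * t * t]mulgA mulTT //
  mulg1 Ts andbT conjT. Qed.

Lemma one_common_nbrs s t : s \in T -> t \in T -> 1 \in common_nbrs s t.
Proof. by move=> Ts Tt; rewrite inE !mul1g Ts. Qed.

Lemma common_nbrsC s t : common_nbrs s t = common_nbrs t s.
Proof. by apply/setP=> a; rewrite !inE andbC. Qed.

Lemma mulT_neq1 s t : t \in T -> (s * t != 1) = (s != t).
Proof. by move=> Tt; rewrite -{1}(mulTT Tt) (inj_eq (mulIg t)). Qed.

(** A commuting pair has the common neighbours 1 and s t. A non-commuting pair has three or one,
    according to whether the third side [t ^ s] of the triangle lies in T. *)
Lemma card_common_nbrs s t : s \in T -> t \in T -> s != t ->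
  (#|common_nbrs s t| == 2) = (s * t == t * s).
Proof.
move=> Ts Tt nst.
have [cst|ncst] := eqVneq (s * t) (t * s).
  have -> : common_nbrs s t = [set 1; s * t].
    apply/setP=> a; rewrite !inE; apply/idP/idP => [Ca|].
      have /common_nbrs_sub[] // : a \in common_nbrs s t by rewrite inE.
      - by move->; rewrite eqxx.
      - by move->; rewrite eqxx orbT.
      by rewrite -cst => ->; rewrite eqxx orbT.
    case/orP=> /eqP->; first by rewrite !mul1g Ts.
    by rewrite -(mulgA s t t) mulTT // mulg1 Ts andbT cst -mulgA mulTT ?mulg1.
  by rewrite cards2 (eq_sym 1) mulT_neq1 // nst.
have Tc := tp_braid (tpT Ts) (tpT Tt) ncst.
have [Tst|nTst] := boolP (t ^ s \in T).
  have -> : common_nbrs s t = [set 1; s * t; t * s].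
    apply/setP=> a; apply/idP/idP => [Ca|].
      by rewrite !inE; case: (common_nbrs_sub Ts Tt nst Ca) => ->;
        rewrite eqxx ?orbT.
    case/setUP=> [/set2P[]|/set1P] ->; first exact: one_common_nbrs.
      by rewrite mulg_common_nbrs.
    by rewrite common_nbrsC mulg_common_nbrs // Tc.
  have nst1 : s * t != 1 by rewrite mulT_neq1.
  have nts1 : t * s != 1 by rewrite mulT_neq1 // eq_sym.
  by rewrite -setUA cardsU1 cards2 !inE !(eq_sym 1) (negPf nst1) (negPf nts1)
    ncst.
have -> : common_nbrs s t = [set 1].
  apply/setP=> a; rewrite [in RHS]inE; apply/idP/eqP => [Ca|->].
    case: (common_nbrs_sub Ts Tt nst Ca) => // E; move: Ca; rewrite E.
      by rewrite mulg_common_nbrs // (negPf nTst).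
    by rewrite common_nbrsC mulg_common_nbrs // Tc (negPf nTst).
  exact: one_common_nbrs.
by rewrite cards1.
Qed.

(** * Automorphisms fixing 1: commutation and triangles *)

Definition stab1 (p : {perm 'S_n}) :=
  p \in graph_aut (cayley_graph T) /\ p 1 = 1.

Lemma stab1V p : stab1 p -> stab1 p^-1.
Proof. by case=> Ap p1; split; rewrite ?groupV // -{1}p1 permK. Qed.

Section Stab.
Variable p : {perm 'S_n}.
Hypothesis Sp : stab1 p.

Lemma stab1_mem t : (p t \in T) = (t \in T).
Proof.
case: Sp => /aut_cayleyP Ap p1.
by have := Ap 1 t; rewrite p1 invg1 !mulg1.
Qed.

Lemma stab1_common_nbrs s t a : s \in T -> t \in T ->
  (p a \in common_nbrs (p s) (p t)) = (a \in common_nbrs s t).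
Proof.
move=> Ts Tt; case: (Sp) => /aut_cayleyP Ap p1; rewrite !inE.
have:= Ap s a; have:= Ap t a; rewrite (invT Ts) (invT Tt) => <- <-.
by rewrite !invT ?stab1_mem.
Qed.

Lemma stab1_commute s t : s \in T -> t \in T ->
  (p s * p t == p t * p s) = (s * t == t * s).
Proof.
move=> Ts Tt; have [->|nst] := eqVneq s t; first by rewrite !eqxx.
rewrite -!card_common_nbrs ?stab1_mem ?(inj_eq perm_inj) //.
congr (_ == _); rewrite -(card_imset (common_nbrs s t) (@perm_inj _ p)).
apply: eq_card => a; apply/idP/imsetP => [Ca|[b Cb ->]].
  exists (p^-1 a); rewrite ?permKV // -stab1_common_nbrs //.
  by rewrite permKV.
by rewrite stab1_common_nbrs.
Qed.

Lemma stab1_mulg s t a : s \in T -> t \in T -> s != t ->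
  a \in common_nbrs s t -> a != 1 -> p a = p s * p t \/ p a = p t * p s.
Proof.
move=> Ts Tt nst Ca na1; rewrite -stab1_common_nbrs // in Ca.
case: (common_nbrs_sub _ _ _ Ca); rewrite ?stab1_mem ?(inj_eq perm_inj) //;
  auto.
by move=> pa1; case/eqP: na1; apply: (@perm_inj _ p); rewrite pa1; case: Sp.
Qed.

Lemma stab1_triangle s t : s \in T -> t \in T -> s * t != t * s ->
  t ^ s \in T -> p (t ^ s) = p t ^ p s.
Proof.
move=> Ts Tt ncst Tr.
have nst : s != t by apply: contraNneq ncst => ->.
have nsr : s != t ^ s.
  by apply: contraNneq nst => E; rewrite -(inj_eq (@conjg_inj _ s))
    -E conjgE mulKg.
have ntr : t != t ^ s.
  by apply: contraNneq ncst => /esym/conjg_fixP/commgP/esym/eqP.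
have Cst : s * t \in common_nbrs s t by rewrite mulg_common_nbrs.
have Csr : s * t \in common_nbrs s (t ^ s).
  move: Cst; rewrite !inE => /andP[-> _] /=.
  rewrite -(tp_braid (tpT Ts) (tpT Tt) ncst) conjT // !mulgA.
  by rewrite -(mulgA s t t) mulTT // mulg1 mulTT // mul1g.
have nst1 : s * t != 1 by rewrite mulT_neq1.
have nptr : p t != p (t ^ s) by rewrite (inj_eq perm_inj).
have pst := stab1_mulg Ts Tt nst Cst nst1.
have psr := stab1_mulg Ts Tr nsr Csr nst1.
have Es (a b : 'S_n) : a * p s = p s * b -> b = a ^ p s.
  by move=> E; rewrite conjgE E mulKg.
have Es' (a b : 'S_n) : p s * a = b * p s -> b = a ^ p s.
  by move=> E; rewrite conjT ?stab1_mem // E -mulgA mulTT ?stab1_mem // mulg1.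
case: pst psr => -> [] E.
- by case/eqP: nptr; apply: (mulgI (p s)).
- exact: Es'.
- exact: Es.
by case/eqP: nptr; apply: (mulIg (p s)).
Qed.
End Stab.

(** * Whitney's argument: stars of edges go to stars *)

Lemma edge_out (S : {set 'I_n}) i : i \in S -> #|S| < n ->
  exists x y, [/\ x \in S, tperm x y \in T & y \notin S].
Proof.
move=> Si ltS.
have [/existsP[x /existsP[y /and3P[Sx Txy Sy]]]|no] :=
  boolP [exists x, [exists y, [&& x \in S, tperm x y \in T & y \notin S]]].
  by exists x, y.
have S_all : forall j, j \in S.
  apply: (edge_closed Si) => x y Sx Txy; apply: contraNT no => nSy.
  by apply/existsP; exists x; apply/existsP; exists y; rewrite Sx Txy.
have : S = setT by apply/setP=> j; rewrite S_all inE.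
by move=> ES; rewrite ES cardsT card_ord ltnn in ltS.
Qed.

(* The p e are pairwise adjacent edges; if they did not share x they would form
   a triangle, so e would close a triangle with (i j) and (i k). *)
Lemma star_image_sub p i j k x y z e : stab1 p ->
  i != j -> i != k -> j != k -> x != y -> x != z -> y != z ->
  tperm i j \in T -> tperm i k \in T ->
  p (tperm i j) = tperm x y -> p (tperm i k) = tperm x z ->
  e \in T -> e i != i -> p e x != x.
Proof.
move=> Sp nij nik njk nxy nxz nyz Tij Tik pij pik Te ei; apply/negP => /eqP pex.
have Tpe : p e \in T by rewrite stab1_mem.
have noncomm l w : tperm i l \in T -> x != w -> p (tperm i l) = tperm x w ->
  p e w != w.
  move=> Til nxw pil; apply/negP => /eqP pew.
  have /eqP : p e * tperm x w = tperm x w * p e.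
    by apply/esym/commgP/conjg_fixP; rewrite tpermJ pex pew.
  rewrite -pil stab1_commute //; apply/negP.
  have nil : e i != l.
    apply: contraNneq nxw => eil; move: pex.
    by rewrite (tp_moved (tpT Te) ei) eil pil tpermL => ->.
  rewrite (tp_moved (tpT Te) ei) star_ncomm //; first by rewrite eq_sym.
  exact: edge_neq Til.
have pey := noncomm _ _ Tij nxy pij; have pez := noncomm _ _ Tik nxz pik.
have Epe : p e = (p (tperm i k)) ^ p (tperm i j).
  rewrite pik pij tpermJ tpermL [tperm x y z]tpermD // {1}(tp_moved (tpT Tpe)
    pey).
  by congr tperm; apply/esym/tp_moved2; rewrite // 1?eq_sym //; apply: tpT.
have nc : p (tperm i j) * p (tperm i k) != p (tperm i k) * p (tperm i j).
  by rewrite stab1_commute // star_ncomm.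
(* [stab1_triangle] for [p^-1] makes [e] the third side of the triangle i j k, which misses i. *)
have Ee : e = tperm j k.
  rewrite -[LHS](permK p) Epe stab1_triangle ?stab1_mem ?permK //; last 2 first.
  - exact: stab1V.
  - by rewrite -Epe.
  by rewrite tpermJ tpermL tpermD.
by rewrite Ee tpermD ?eqxx 1?eq_sym in ei.
Qed.

(** The centre x is the common end of the images of two edges at i; [star_image_sub] for [p] and for
    [p^-1] gives the two implications. *)
Lemma star_image2 p i j k : stab1 p -> j != k ->
  tperm i j \in T -> tperm i k \in T ->
  exists x, forall e, e \in T -> (p e x != x) = (e i != i).
Proof.
move=> Sp njk Tij Tik.
have [nij nik] := (edge_neq Tij, edge_neq Tik).
have nc : p (tperm i j) * p (tperm i k) != p (tperm i k) * p (tperm i j).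
  by rewrite stab1_commute // star_ncomm.
have [||x [y [z [nxy nxz nyz Es Et]]]] := tp_common _ _ nc.
- by apply: tpT; rewrite stab1_mem.
- by apply: tpT; rewrite stab1_mem.
exists x => e Te; apply/idP/idP => [pex|]; last exact: star_image_sub Es Et Te.
rewrite -[e](permK p).
apply: (star_image_sub (stab1V Sp) nxy nxz nyz nij nik njk);
  rewrite ?stab1_mem //.
- by rewrite -Es stab1_mem.
- by rewrite -Et stab1_mem.
- by rewrite -Es permK.
by rewrite -Et permK.
Qed.

(** Degree at least two is [star_image2]. If i is a leaf attached to j, the star of j has an image
    centre y, and the other end of the image of (i j) serves for i. *)
Lemma star_image p i : 2 < n -> stab1 p ->
  exists x, forall e, e \in T -> (p e x != x) = (e i != i).
Proof.
move=> n_gt2 Sp.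
have [||_ [j [/set1P-> Tij]]] := @edge_out [set i] i; rewrite ?set11 ?cards1 //.
  exact: ltnW.
rewrite inE => nji.
have [||a [k [/set2P Sa Tak]]] := @edge_out [set i; j] i; rewrite ?set21 //.
  by rewrite cards2 (leq_ltn_trans _ n_gt2) // ltnS leq_b1.
rewrite !inE negb_or => /andP[nki nkj].
have njk : j != k by rewrite eq_sym.
have nij : i != j by rewrite eq_sym.
case: Sa Tak => -> Tak; first exact: star_image2 Tij Tak.
have Tji : tperm j i \in T by rewrite tpermC.
have [y Hy] : exists y, forall e, e \in T -> (p e y != y) = (e j != j).
  by apply: star_image2 Tji Tak => //; rewrite eq_sym.
have [/existsP[l /andP[nlj Til]]|no] := boolP [exists l, (l != j)
  && (tperm i l \in T)].
  exact: star_image2 Til Tij.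
set s := tperm i j in Tij *.
have tps : is_tperm (p s) by apply: tpT; rewrite stab1_mem.
have sy : p s y != y by rewrite Hy // tpermR.
have sx : p s (p s y) != p s y by rewrite (inj_eq perm_inj).
exists (p s y) => e Te; have tpe : is_tperm (p e) by apply: tpT;
  rewrite stab1_mem.
have [->|nes] := eqVneq e s; first by rewrite sx tpermL eq_sym nij.
have ei : e i = i.
  apply/eqP; apply: contraNT no => ei; apply/existsP; exists (e i).
  rewrite -tp_moved ?Te //; last exact: tpT. 
  rewrite andbT; apply: contraNneq nes => Ej; rewrite (tp_moved (tpT Te) ei)
    Ej //.
(* Otherwise [p e] meets [p s] at [p s y], so e and s do not commute and e moves j; then [p e] also
   moves y and equals [p s]. *)
rewrite ei eqxx; apply/negbTE/negP => ex.
have : p e * p s != p s * p e.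
  by apply: (moved_ncomm (x := p s y)); rewrite ?(inj_eq (@perm_inj _ p)).
rewrite stab1_commute //; apply/negP; rewrite negbK.
have [ej|ej] := eqVneq (e j) j.
  by apply/eqP/esym/commgP/conjg_fixP; rewrite tpermJ ei ej.
move: ej; rewrite -Hy // => ey; case/eqP: nes; apply: (@perm_inj _ p).
rewrite (tp_moved tpe ey) [RHS](tp_moved tps sy); congr tperm.
by apply/esym/tp_moved2.
Qed.

(** The star centres define a vertex map f, and for t = (i j) the transposition [p t] moves both f i
    and f j. *)
Lemma stab1_conj p : 2 < n -> stab1 p ->
  exists2 h, h \in graph_aut (transposition_graph T) &
             forall t, t \in T -> p t = t ^ h.
Proof.
move=> n_gt2 Sp.
have [f Hf] := fin_all_exists (fun i => star_image i n_gt2 Sp).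
(* An edge leaving {i, j} moves exactly one of i and j, which separates their images. *)
have f_inj : injective f.
  move=> i j fij; apply/eqP; apply/negPn/negP => nij.
  have [||a [k [/set2P Sa Tak]]] := @edge_out [set i; j] i; rewrite ?set21 //.
    by rewrite cards2 (leq_ltn_trans _ n_gt2) // ltnS leq_b1.
  have Ek : tperm a k k != k by rewrite tpermR edge_neq.
  rewrite !inE negb_or => /andP[nki nkj].
  have Eij : (tperm a k i != i) = (tperm a k j != j) by rewrite -(Hf i _ Tak)
    -(Hf j _ Tak) fij.
  case: Sa Tak Eij {Ek} => -> Tak; rewrite tpermL.
    by rewrite [tperm i k j]tpermD // nki eqxx.
  rewrite [tperm j k i]tpermD // ?eqxx ?nkj //.
  by rewrite eq_sym.
have Ep t : t \in T -> p t = t ^ perm f_inj.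
  move=> Tt; have [i [j [nij Et]]] := tpT Tt.
  have tpp : is_tperm (p t) by apply: tpT; rewrite stab1_mem.
  have pi : p t (f i) != f i by rewrite Hf // Et tpermL eq_sym.
  have pj : p t (f j) != f j by rewrite Hf // Et tpermR.
  rewrite (tp_moved tpp pi) Et tpermJ !permE; congr tperm.
  by rewrite -Et; apply/esym/tp_moved2; rewrite // (inj_eq f_inj) eq_sym.
exists (perm f_inj) => //; apply/aut_transP => t.
apply/idP/idP => [Tth|Tt]; last by rewrite -Ep ?stab1_mem.
have Tu : p^-1 (t ^ perm f_inj) \in T by rewrite stab1_mem //; apply: stab1V.
by have := Ep _ Tu; rewrite permKV => /conjg_inj->.
Qed.

(** * Automorphisms fixing 1 and T pointwise, and their jumps *)

Definition stabT (p : {perm 'S_n}) := stab1 p /\ forall t, t \in T -> p t = t.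

Definition jump p t d :=
  [/\ stabT p, t \in T, d \in graph_aut (transposition_graph T)
    & forall s, s \in T -> p (s * t) = s ^ d * t].

(** Moving the base point from 1 to t and undoing d gives an automorphism that again fixes 1 and T,
    so the analysis can be repeated along words in T. *)
Lemma jump_shift p t d : stab1 p -> t \in T -> p t = t ->
  d \in graph_aut (transposition_graph T) ->
  (forall s, s \in T -> p (s * t) = s ^ d * t) ->
  exists2 q, stabT q & forall a, p (a * t) = q a ^ d * t.
Proof.
move=> [Ap p1] Tt pt Ad H.
pose q := bitrans t 1 * p * bitrans t 1 * bitrans d^-1 d^-1.
have qE a : q a = (p (a * t) * t) ^ d^-1.
  by rewrite !permM !bitransE conjgE !invg1 !mul1g !mulgA.
exists q => [|a]; last by rewrite qE conjgKV -mulgA mulTT // mulg1.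
split; first split.
- by rewrite !groupM ?bitrans_aut ?groupV ?group1.
- by rewrite qE mul1g pt mulTT // conj1g.
by move=> s Ts; rewrite qE H // -mulgA mulTT // mulg1 conjgK.
Qed.

Lemma jump_next p t d : jump p t d ->
  exists2 q, stabT q & forall a, p (a * t) = q a ^ d * t.
Proof. by case=> -[Sp pT] Tt Ad H; apply: jump_shift => //; apply: pT. Qed.

Lemma jump_exists p t : 2 < n -> stabT p -> t \in T -> exists d, jump p t d.
Proof.
move=> n_gt2 [[Ap p1] pT] Tt.
have [|d Ad H] := @stab1_conj (bitrans t 1 * p * bitrans t 1) n_gt2.
  split; first by rewrite !groupM ?bitrans_aut ?group1.
  by rewrite !permM !bitransE !invg1 !mul1g pT ?mulTT.
exists d; split=> // s Ts.
by rewrite -H // !permM !bitransE !invg1 !mul1g -[RHS]mulgA mulTT ?mulg1.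
Qed.

Lemma jump_self p t d : jump p t d -> t ^ d = t.
Proof.
case=> -[[Ap p1] _] Tt _ H; have := H t Tt.
by rewrite mulTT // p1 => E; rewrite -[LHS](mulgK t) -E mul1g invT.
Qed.

Lemma jump_commute p s t d : jump p t d -> s \in T -> s * t = t * s ->
  s ^ d = s.
Proof.
move=> J Ts cst; have [->|nst] := eqVneq s t; first exact: jump_self J.
case: J => -[Sp pT] Tt _ H; apply: (mulIg t); rewrite -H //.
have Cst : s * t \in common_nbrs s t by rewrite mulg_common_nbrs //
  conjgE -cst mulKg.
have nst1 : s * t != 1 by rewrite mulT_neq1.
by case: (stab1_mulg Sp Ts Tt nst Cst nst1); rewrite (pT s) ?(pT t) -?cst.
Qed.

(** Since [p] fixes s and t, it sends their common neighbour s t to s t or t s. *)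
Lemma jump_triangle p s t d : jump p t d -> s \in T -> s * t != t * s ->
  s ^ t \in T -> s ^ d = s \/ s ^ d = s ^ t.
Proof.
case=> -[Sp pT] Tt _ H Ts ncst Tst.
have nst : s != t by apply: contraNneq ncst => ->.
have Cst : s * t \in common_nbrs s t.
  by rewrite mulg_common_nbrs // -(tp_braid (tpT Ts) (tpT Tt) ncst).
have nst1 : s * t != 1 by rewrite mulT_neq1.
case: (stab1_mulg Sp Ts Tt nst Cst nst1); rewrite H // (pT s) ?(pT t) // => E.
  by left; apply: (mulIg t).
by right; rewrite (conjT s Tt) -E -mulgA mulTT ?mulg1.
Qed.

(** As [p (s * t)] is already t s, injectivity forbids [p (t * s)] to be t s as well. *)
Lemma jump_triangle_swap p s t d c : jump p t d -> jump p s c ->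
  s * t != t * s -> s ^ t \in T -> s ^ d = s ^ t -> t ^ c = t ^ s.
Proof.
move=> Jt Js ncst Tst E; have [[Sp pT] Tt _ H] := Jt; have [_ Ts _ H'] := Js.
have ncts : t * s != s * t by rewrite eq_sym.
have Ets := tp_braid (tpT Ts) (tpT Tt) ncst.
have [||//] := jump_triangle Js Tt ncts; first by rewrite -Ets.
move=> Etc; have : p (s * t) = p (t * s).
  by rewrite H // H' // E Etc (conjT s Tt) -mulgA mulTT ?mulg1.
by move/perm_inj => /eqP; rewrite (negPf ncst).
Qed.

(* Evaluate p on both sides of t s t = s t s. *)
Lemma jump_hexagon p s t c d : 2 < n -> jump p t d -> jump p s c ->
  s * t != t * s -> exists q c' r d', [/\ jump q s c', jump r t d'
    & (t ^ c' * s) ^ d * t = (s ^ d' * t) ^ c * s].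
Proof.
move=> n_gt2 Jt Js ncst.
have [[_ Tt _ _] [_ Ts _ _]] := (Jt, Js).
have [q Kq Eq] := jump_next Jt; have [r Kr Er] := jump_next Js.
have [c' Jc'] := jump_exists n_gt2 Kq Ts.
have [d' Jd'] := jump_exists n_gt2 Kr Tt.
exists q, c', r, d'; split=> //.
case: (Jc') => _ _ _ <- //; case: (Jd') => _ _ _ <- //.
rewrite -Eq -Er; congr (p _).
by have := tp_braid (tpT Ts) (tpT Tt) ncst; rewrite !conjT // => ->.
Qed.

(** * Action of jumps on vertices, and consequences of the hexagon *)

Lemma jump_ends p i j d : jump p (tperm i j) d ->
  (d i = i /\ d j = j) \/ (d i = j /\ d j = i).
Proof.
move=> J; have [_ Tij _ _] := J.
by have := jump_self J; rewrite tpermJ => /esym/(tperm_eq (edge_neq Tij)).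
Qed.

Lemma jump_edge p i j k l d : jump p (tperm i j) d -> tperm k l \in T ->
  k != i -> k != j -> l != i -> l != j ->
  (d k = k /\ d l = l) \/ (d k = l /\ d l = k).
Proof.
move=> J Tkl nki nkj nli nlj; apply: tperm_eq; first exact: edge_neq.
rewrite -tpermJ; apply/esym/(jump_commute J Tkl)/commgP/conjg_fixP.
by rewrite tpermJ !tpermD // eq_sym.
Qed.

(** The image of (i k) is (i k) or (j k), and [d i] is i or j, which leaves k for [d k]. *)
Lemma jump_apex p i j k d : jump p (tperm i j) d ->
  tperm i k \in T -> tperm j k \in T -> d k = k.
Proof.
move=> J Tik Tjk; have [_ Tij _ _] := J.
have [[nij nik] njk] := (edge_neq Tij, edge_neq Tik, edge_neq Tjk).
have E : tperm i k ^ tperm i j = tperm j k by rewrite tpermJ tpermL tpermD.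
have nc : tperm i k * tperm i j != tperm i j * tperm i k.
  by rewrite star_ncomm // eq_sym.
have := jump_triangle J Tik nc; rewrite E Tjk tpermJ => /(_ isT).
have ndik : d i != k by case: (jump_ends J) => -[-> _].
case=> /esym/tperm_eq.
  by move/(_ nik) => [][] // dik; rewrite dik eqxx in ndik.
by move/(_ njk) => [][] // dik; rewrite dik eqxx in ndik.
Qed.

Lemma jump_apex_swap p i j k d c : jump p (tperm i j) d -> jump p (tperm i k)
  c ->
  tperm j k \in T -> d i = j -> c i = k.
Proof.
move=> Jt Js Tjk dij; have [[_ Tij _ _] [_ Tik _ _]] := (Jt, Js).
have [[nij nik] njk] := (edge_neq Tij, edge_neq Tik, edge_neq Tjk).
have nc : tperm i k * tperm i j != tperm i j * tperm i k.
  by rewrite star_ncomm // eq_sym.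
have E : tperm i k ^ tperm i j = tperm j k by rewrite tpermJ tpermL tpermD.
have := jump_triangle_swap Jt Js nc; rewrite E Tjk => /(_ isT).
have -> : tperm i k ^ d = tperm j k by rewrite tpermJ dij (jump_apex Jt Tik
  Tjk).
move=> /(_ erefl); rewrite !tpermJ tpermL [tperm i k j]tpermD //; last
  by rewrite eq_sym.
have [[-> _]|[]//] := jump_ends Js.
have nkj : k != j by rewrite eq_sym.
by case/esym/(tperm_eq nkj)=> -[E1 _] //; rewrite E1 eqxx in nij.
Qed.

Lemma aut_edge d i j : d \in graph_aut (transposition_graph T) ->
  (tperm (d i) (d j) \in T) = (tperm i j \in T).
Proof. by move/aut_transP => H; rewrite -tpermJ H. Qed.

(** If d swapped i and j, then (j, d k) would be an edge, so [d k] is not k. The hexagon then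
    equates a transposition u with a product sending i to [d k] and [d k] to k, which is not an
    involution. *)
Lemma hexagon_noswap p i j k d : 2 < n -> jump p (tperm i j) d ->
  tperm i k \in T -> tperm j k \notin T -> j != k ->
  (forall q c, jump q (tperm i k) c -> c i = i /\ c j = j) -> d i = i.
Proof.
move=> n_gt2 Jt Tik nTjk njk fixij.
have [Kp Tij Ad _] := Jt.
have [nij nik] := (edge_neq Tij, edge_neq Tik).
have [[//]|[di dj]] := jump_ends Jt.
have nc : tperm i k * tperm i j != tperm i j * tperm i k.
  by rewrite star_ncomm // eq_sym.
have [c Js] := jump_exists n_gt2 Kp Tik.
have [q [c' [r [d' [Js' Jt']]]]] := jump_hexagon n_gt2 Jt Js nc.
have [c'i c'j] := fixij _ _ Js'; have [ci cj] := fixij _ _ Js.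
have -> : tperm i j ^ c' = tperm i j by rewrite tpermJ c'i c'j.
have dki : d k != i by rewrite -dj (inj_eq perm_inj) eq_sym.
have dkj : d k != j by rewrite -di (inj_eq perm_inj) eq_sym.
have dkk : d k != k.
  by apply: contraNneq nTjk => <-; rewrite -{1}di aut_edge.
rewrite (conjMg (tperm i j)) (conjMg (tperm i k ^ d')) (jump_self Jt)
  [tperm i k ^ d]tpermJ di [tperm i j ^ c]tpermJ ci cj => E.
set u := (tperm i k ^ d') ^ c in E.
have tu : is_tperm u by do 2!apply: tp_conj; exists i, k.
have Eu : u = tperm i j * tperm j (d k) * tperm i j * tperm i k * tperm i j.
  by rewrite E -(mulgA (u * _)) mulTT // mulg1 -(mulgA u) mulTT // mulg1.
have ui : u i = d k.
  rewrite Eu !permM tpermL tpermL [tperm i j (d k)]tpermD 1?eq_sym //.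
  by rewrite [tperm i k (d k)]tpermD 1?eq_sym // tpermD // eq_sym.
have udk : u (d k) = k.
  rewrite Eu !permM [tperm i j (d k)]tpermD 1?eq_sym // tpermR tpermR tpermL.
  by rewrite tpermD.
by have := tp_invol i tu; rewrite ui udk => Eki; rewrite Eki eqxx in nik.
Qed.

Definition jumps_fix_ends :=
  forall p i j d, jump p (tperm i j) d -> d i = i.

(** All four jumps fix the ends of their edges, so each side of the hexagon is a product of three
    transpositions moving i. If d moved k, the sides would differ at i or at k. *)
Lemma hexagon_star p i j k d : 2 < n -> jumps_fix_ends ->
  jump p (tperm i j) d -> tperm i k \in T -> j != k -> d k = k.
Proof.
move=> n_gt2 fixes Jt Tik njk.
have fixesr q x y e : jump q (tperm x y) e -> e y = y.
  by rewrite tpermC => /fixes.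
have [Kp Tij Ad _] := Jt.
have [nij nik] := (edge_neq Tij, edge_neq Tik).
have nc : tperm i k * tperm i j != tperm i j * tperm i k.
  by rewrite star_ncomm // eq_sym.
have [c Js] := jump_exists n_gt2 Kp Tik.
have [q [c' [r [d' [Js' Jt' /permP E]]]]] := jump_hexagon n_gt2 Jt Js nc.
have [di dj ci ck] := And4 (fixes _ _ _ _ Jt) (fixesr _ _ _ _ Jt)
                           (fixes _ _ _ _ Js) (fixesr _ _ _ _ Js).
have [c'i c'k d'i d'j] := And4 (fixes _ _ _ _ Js') (fixesr _ _ _ _ Js')
                              (fixes _ _ _ _ Jt') (fixesr _ _ _ _ Jt').
apply/eqP/negPn/negP => ndk.
have [dki dkj] : d k != i /\ d k != j.
  by rewrite -{1}di -{1}dj !(inj_eq perm_inj) !(eq_sym k).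
have {}E z : tperm i j (tperm i (d k) (tperm i (d (c' j)) z)) =
             tperm i k (tperm i (c j) (tperm i (c (d' k)) z)).
  move: (E z); rewrite (conjMg _ _ d) (conjMg _ _ c) !tpermJ !permM.
  by rewrite c'i di d'i ci.
have nj2i : c j != i by rewrite -ci (inj_eq perm_inj) eq_sym.
have nj2k : c j != k by rewrite -ck (inj_eq perm_inj).
have [nij' nik' nkj] : [/\ j != i, k != i & k != j] by split; rewrite eq_sym.
have [ndk' ndki' ndkj'] : [/\ k != d k, i != d k & j != d k].
  by split; rewrite eq_sym.
have [nj2i' nj2k'] : i != c j /\ k != c j by split; rewrite eq_sym.
(* The cases ask, for each side, whether the transposition applied first is (i k). *)
move: (E i) (E k); have [->|nj1k] := eqVneq (d (c' j)) k.
  rewrite (tpermL i k) (tpermR i k) (tpermL i (d k)) (tpermL i (c (d' k))).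
  rewrite [tperm i (d k) k]tpermD // [tperm i j k]tpermD //.
  rewrite [tperm i j (d k)]tpermD //.
  have [->|nk3k] := eqVneq (c (d' k)) k.
    rewrite [tperm i (c j) k]tpermD // tpermR => Eki.
    by rewrite Eki eqxx in nik.
  move=> _; rewrite [tperm i (c (d' k)) k]tpermD // [tperm i (c j) k]tpermD //.
  by rewrite tpermR => Edk; rewrite Edk eqxx in dki.
move=> _; rewrite [tperm i (d (c' j)) k]tpermD // [tperm i (d k) k]tpermD //
  [tperm i j k]tpermD //.
have [->|nk3k] := eqVneq (c (d' k)) k.
  rewrite tpermR tpermL tpermD // => Ek.
  by rewrite -Ek eqxx in nj2k.
rewrite [tperm i (c (d' k)) k]tpermD // [tperm i (c j) k]tpermD //
  tpermR => Eki.
by rewrite Eki eqxx in nik.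
Qed.

(** * Jumps fix the ends of their edges *)

Hypothesis n_ge5 : 4 < n.
Let n_gt2 : 2 < n. Proof. exact: leq_trans n_ge5. Qed.

(* Otherwise (j l) is no edge, and jumps at (i l) fix (j k) and (j, d l), hence
   j and i, contradicting [hexagon_noswap]. *)
Lemma jump_swap_twins p i j k l d : jump p (tperm i j) d -> d i = j ->
  tperm i k \in T -> tperm j k \in T ->
  tperm i l \in T -> l != j -> tperm j l \in T.
Proof.
move=> J di Tik Tjk Til nlj; apply: contraT => nTjl.
have [_ Tij Ad _] := J.
have [[nij nik] [njk nil]] :=
  (edge_neq Tij, edge_neq Tik, (edge_neq Tjk, edge_neq Til)).
have dj : d j = i by case: (jump_ends J) => -[] //; rewrite di => Eji;
  rewrite Eji eqxx in nij.
have dk := jump_apex J Tik Tjk.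
have Tjdl : tperm j (d l) \in T by rewrite -di aut_edge.
have nlk : l != k by apply: contraNneq nTjl => ->.
have ndlk : d l != k by rewrite -dk (inj_eq perm_inj).
have ndli : d l != i by rewrite -dj (inj_eq perm_inj).
have ndll : d l != l by apply: contraNneq nTjl => <-.
have: d i = i.
  apply: (hexagon_noswap n_gt2 J Til nTjl); first by rewrite eq_sym.
  move=> q c Jc; have [_ _ Ac _] := Jc.
  have cj : c j = j.
    have [||||[] //|[cj _]] := jump_edge Jc Tjk; rewrite 1?eq_sym //.
    have [||||[] //|[]] := jump_edge Jc Tjdl; rewrite // 1?eq_sym // cj => Ek.
    by rewrite -Ek eqxx in ndlk.
  (* With j fixed, a [c] swapping i and l would map the edge (i j) to the non-edge (l j). *)
  split=> //; have [[]|[ci _]] // := jump_ends Jc.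
  by case/negP: nTjl; rewrite tpermC -ci -{1}cj aut_edge.
by rewrite di => Eji; rewrite Eji eqxx in nij.
Qed.

Hypothesis not_complete : exists x y, x != y /\ tperm x y \notin T.

(** A swap on an edge in a triangle makes its ends twins. [jump_apex_swap] spreads it to all edges
    at i, so each neighbour of i is a twin of i; by connectedness i is adjacent to every other
    vertex, and G(T) is complete. *)
Lemma jump_noswap_triangle p i j k d : jump p (tperm i j) d ->
  tperm i k \in T -> tperm j k \in T -> d i = i.
Proof.
move=> J Tik Tjk; have [[//]|[di dj]] := jump_ends J.
have [Kp Tij Ad _] := J.
have twin x : x != i -> tperm i x \in T ->
    forall y, y != i -> y != x -> (tperm x y \in T) = (tperm i y \in T).
  have swap_twin z e : jump p (tperm i z) e -> e i = z ->
     forall x, tperm i x \in T -> tperm z x \in T -> 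
     forall y, y != i -> y != z -> (tperm z y \in T) = (tperm i y \in T).
    move=> Jz ei x' Tix Tzx y nyi nyz; apply/idP/idP => Ty.
      have [[]|[_ ez]] := jump_ends Jz.
        by rewrite ei => Ezi; move: Ty; rewrite Ezi.
      by apply: (jump_swap_twins (p := p) (d := e) _ ez Tzx) => //;
        rewrite tpermC.
    exact: (jump_swap_twins Jz ei Tix).
  move=> nxi Tix; have [->|nxj] := eqVneq x j; first exact:
    swap_twin J di _ Tik Tjk.
  have Tjx : tperm j x \in T by rewrite (swap_twin _ _ J di _ Tik Tjk).
  have [e Je] := jump_exists n_gt2 Kp Tix.
  apply: (swap_twin _ _ Je _ j) => //; last by rewrite tpermC.
  exact: jump_apex_swap J Je Tjx di.
have univ y : y != i -> tperm i y \in T.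
  move=> nyi.
  have : y \in [set x | (x == i) || (tperm i x \in T)].
    apply: (@edge_closed _ i); first by rewrite inE eqxx.
    move=> x z; rewrite !inE; have [->|nxi] //= := eqVneq x i.
      by move=> _ ->; rewrite orbT.
    move=> Tix Txz; have [->|nzi] //= := eqVneq z i.
    by rewrite -(twin x) // eq_sym edge_neq.
  by rewrite inE (negPf nyi).
have [x [y [nxy]]] := not_complete; case/negP.
have [Exi|nxi] := eqVneq x i; first by rewrite Exi univ // -Exi eq_sym.
have [->|nyi] := eqVneq y i; first by rewrite tpermC univ.
by rewrite twin ?univ // eq_sym.
Qed.

(* A neighbour y of j other than i and d k would make every jump at (i k) fix
   the two edges (j y) and (j, d k), hence i and j. *)
Lemma jump_swap_degree p i j k d y : jump p (tperm i j) d -> d i = j ->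
  tperm i k \in T -> k != j ->
  tperm j y \in T -> y != i -> y = d k.
Proof.
move=> J di Tik nkj Tjy nyi; apply/eqP/negPn/negP => nydk.
have [_ Tij Ad _] := J.
have [[nij nik] njy] := (edge_neq Tij, edge_neq Tik, edge_neq Tjy).
have dj : d j = i.
  by case: (jump_ends J) => -[] //; rewrite di => Eji; rewrite Eji eqxx in nij.
have nTjk : tperm j k \notin T.
  apply/negP => Tjk; have := jump_noswap_triangle J Tik Tjk.
  by rewrite di => Eji; rewrite Eji eqxx in nij.
have Tjdk : tperm j (d k) \in T by rewrite -di aut_edge.
have nyk : y != k by apply: contraNneq nTjk => <-.
have ndkk : d k != k by apply: contraNneq nTjk => {1}<-.
have ndki : d k != i by rewrite -dj (inj_eq perm_inj).
have: d i = i.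
  apply: (hexagon_noswap n_gt2 J Tik nTjk); first by rewrite eq_sym.
  move=> q c Jc; have [_ _ Ac _] := Jc.
  have cj : c j = j.
    have [||||[] //|[cj _]] := jump_edge Jc Tjy; rewrite // 1?eq_sym //.
    have [||||[] //|[]] := jump_edge Jc Tjdk; rewrite // 1?eq_sym // cj => Ey.
    by rewrite Ey eqxx in nydk.
  split=> //; have [[]|[ci _]] // := jump_ends Jc.
  by case/negP: nTjk; rewrite tpermC -ci -{1}cj aut_edge.
by rewrite di => Eji; rewrite Eji eqxx in nij.
Qed.

(* If d swaps i and j, then {i, j, k, d k} is closed under adjacency. *)
Lemma jump_swap_pendant p i j k d : jump p (tperm i j) d ->
  tperm i k \in T -> k != j -> d i = i.
Proof.
move=> J Tik nkj; have [[//]|[di dj]] := jump_ends J.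
have [_ Tij Ad _] := J.
have [nij nik] := (edge_neq Tij, edge_neq Tik).
have degj := jump_swap_degree J di Tik nkj.
have Tjdk : tperm j (d k) \in T by rewrite -di aut_edge.
have ndki : d k != i by rewrite -dj (inj_eq perm_inj).
have ndkj : d k != j by rewrite -di (inj_eq perm_inj) eq_sym.
have ndkk : d k != k.
  apply/eqP => dk; move: Tjdk; rewrite dk => Tjk.
  have := jump_noswap_triangle J Tik Tjk.
  by rewrite di => Eji; rewrite Eji eqxx in nij.
(* As n exceeds 4, some edge (x y) leaves these at most four vertices. For x = i its image (j, d y)
   contradicts [degj], for x = j the edge itself does; for the other x it avoids i and j, so d
   preserves it, which forces [d k = k] or puts y in the set. *)
have [||x [y [Sx Txy Sy]]] := @edge_out [set z in [:: i; j; k; d k]] i.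
- by rewrite !inE eqxx.
- by rewrite cardsE (leq_ltn_trans (card_size _)).
move: Sy; rewrite !inE !negb_or => /and4P[nyi nyj nyk nydk].
move: Sx Txy; rewrite !inE => /or4P[] /eqP-> Txy.
- have Tjdy : tperm j (d y) \in T by rewrite -di aut_edge.
  have ndyi : d y != i by rewrite -dj (inj_eq perm_inj).
  have /perm_inj Eyk := degj _ Tjdy ndyi.
  by rewrite Eyk eqxx in nyk.
- by rewrite (degj y) ?eqxx in nydk.
- have [||||[Edk _]|[Edk _]] := jump_edge J Txy; rewrite // 1?eq_sym //.
    by rewrite Edk eqxx in ndkk.
  by rewrite Edk eqxx in nydk.
have [||||[Edk _]|[_ Edk]] := jump_edge J Txy; rewrite // 1?eq_sym //.
  by case/eqP: ndkk; apply: (@perm_inj _ d).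
by case/eqP: nyk; apply: (@perm_inj _ d).
Qed.

Lemma jump_noswap : jumps_fix_ends.
Proof.
move=> p i j d J; have [[//]|[di dj]] := jump_ends J.
have [_ Tij _ _] := J; have nij := edge_neq Tij.
have [||x [k [/set2P[]-> Txk]]] := @edge_out [set i; j] i.
- by rewrite !inE eqxx.
- by rewrite cards2 (leq_ltn_trans _ n_gt2) // ltnS leq_b1.
- by rewrite !inE negb_or => /andP[_ nkj]; apply: jump_swap_pendant J Txk nkj.
rewrite !inE negb_or => /andP[nki _]; rewrite tpermC in J.
have := jump_swap_pendant J Txk nki.
by rewrite dj => Eij; rewrite Eij eqxx in nij.
Qed.

(** * From trivial jumps to the full automorphism group *)

Lemma jump_trivial p t d s : jump p t d -> s \in T -> s ^ d = s.
Proof.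
move=> J Ts; have [_ Tt _ _] := J.
have [/(jump_commute J Ts)//|nc] := eqVneq (s * t) (t * s).
have [i [k [j [nik nij nkj Es Et]]]] := tp_common (tpT Ts) (tpT Tt) nc.
move: J Ts; rewrite Es Et tpermJ => J Tik.
by rewrite (jump_noswap J) (hexagon_star n_gt2 jump_noswap J Tik) // eq_sym.
Qed.

(** Induction on the length of a word in T: the jump at the last letter t is trivial, so p (a t) =
    q(a) t for some [q] that again fixes 1 and T. *)
Lemma stabT_trivial p a : stabT p -> p a = a.
Proof.
have : a \in <<T>> by rewrite hgen inE.
case/gen_prodgP => m [c Tc ->] {a}.
elim: m c Tc p => [|m IHm] c Tc p Kp; first by rewrite big_ord0; case:
  Kp => -[].
rewrite big_ord_recr /=; set t := c ord_max.
have Tt : t \in T by apply: Tc.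
have [d J] := jump_exists n_gt2 Kp Tt.
have [[Sp pT] _ _ H] := J.
have [s Ts|q Kq ->] := jump_shift Sp Tt (pT t Tt) (group1 _).
  by rewrite conjg1 H // (jump_trivial J).
by rewrite conjg1 IHm.
Qed.

(** Right translation by the inverse of [p 1] makes [p] fix 1, and conjugation by [h^-1] then makes
    it fix T pointwise. Undoing both gives p a = h^-1 a h (p 1). *)
Lemma graph_aut_cayley p : p \in graph_aut (cayley_graph T) ->
  exists g, exists2 h, h \in graph_aut (transposition_graph T)
    & p = bitrans g h.
Proof.
move=> Ap; pose g := p 1.
have [|h Ah Eh] := @stab1_conj (p * bitrans g^-1 1) n_gt2.
  split; first by rewrite !groupM ?bitrans_aut ?group1.
  by rewrite permM bitransE invg1 !mul1g mulgV.
have Kq : stabT (p * bitrans g^-1 1 * bitrans h^-1 h^-1).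
  split; first split.
  - by rewrite !groupM ?bitrans_aut ?group1 ?groupV.
  - by rewrite !permM !bitransE !invg1 !mul1g mulgV mulg1 invgK mulgV.
  by move=> t Tt; rewrite permM Eh // bitransE -[RHS](conjgK h t)
    [RHS]conjgE -[LHS]mulgA.
exists (h * g), h => //; apply/permP => a.
have := stabT_trivial a Kq; rewrite !permM !bitransE invg1 mul1g invgK => E.
by rewrite -[in RHS]E !mulgA mulVg mul1g !mulgKV.
Qed.

Lemma bitransM g1 g2 h1 h2 :
  bitrans (g1 * g2) (h1 * h2) = bitrans g1 h1 * bitrans g2 h2.
Proof. by apply/permP => a; rewrite permM !bitransE invMg !mulgA. Qed.

(** Evaluation at 1 gives g = h, so g is central. If g moved i, then (i k) with k outside {i, g i}
    would not commute with g. *)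
Lemma bitrans_eq1 g h : bitrans g h = 1 -> g = 1 /\ h = 1.
Proof.
move/permP => E; have := E 1; rewrite bitransE perm1 mulg1 => /eqP.
rewrite -eq_invg_mul invgK => /eqP Ehg; subst h.
have cg a : a ^ g = a by have := E a; rewrite bitransE perm1 conjgE mulgA.
suff -> : g = 1 by [].
apply/permP => i; rewrite perm1; apply/eqP/negPn/negP => ngi.
have [||_ [k [_ _]]] := @edge_out [set i; g i] i; first by rewrite set21.
  by rewrite cards2 (leq_ltn_trans _ n_gt2) // ltnS leq_b1.
rewrite !inE negb_or eq_sym => /andP[nik nkgi].
have := cg (tperm i k); rewrite tpermJ => /esym/(tperm_eq nik)[][Egi _].
  by rewrite Egi eqxx in ngi.
by rewrite Egi eqxx in nkgi.
Qed.

End Cayley.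

(** * The isomorphism, built from the product side by [bitrans] *)

Theorem corollary2 (n : nat) (T : {set 'S_n}) (hn : (5 <= n)%N)
    (hT : forall t : 'S_n, t \in T -> transposition t)
    (hgen : <<T>> = [set: 'S_n])
    (hK : ~ graph_iso (transposition_graph T) (complete_graph 'I_n)) :
  graph_aut (cayley_graph T) \isog
    setX [set: 'S_n] (graph_aut (transposition_graph T)).
Proof.
have ncomplete : exists x y : 'I_n, x != y /\ tperm x y \notin T.
  have [/existsP[x /existsP[y /andP[nxy nTxy]]]|all_edges] :=
    boolP [exists x : 'I_n, [exists y, (x != y) && (tperm x y \notin T)]].
    by exists x, y.
  case: hK; exists id => [|x y]; first by exists id.
  rewrite (adj_transposition_graph hT) /adj inE cards2 eqSS eqb1.
  apply/idP/idP => [nxy|]; last exact: edge_neq hT _ _.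
  apply: contraNT all_edges => nTxy.
  by apply/existsP; exists x; apply/existsP; exists y; rewrite nxy.
rewrite isog_sym.
pose f (x : 'S_n * 'S_n) := bitrans x.1 x.2.
have fM : {in setX [set: 'S_n] (graph_aut (transposition_graph T)) &,
  {morph f : x y / x * y}} by move=> x y _ _; apply: bitransM.
apply/isogP; exists (Morphism fM).
  apply/subsetP=> -[g h] /setIP[_]; rewrite !inE => /eqP.
  by case/(bitrans_eq1 hT hgen hn) => /= -> ->; rewrite ?eqxx.
rewrite morphimEdom; apply/setP=> p; apply/imsetP/idP => [[[g h]]|].
  by case/setXP => _ Ah ->; apply: bitrans_aut.
case/(graph_aut_cayley hT hgen hn ncomplete) => g [h Ah ->].
by exists (g, h) => //; apply/setXP; rewrite in_setT.
Qed.
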